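(* For any $n \geq 0$, the poset $(\mathsf{Cl}_{\mathbf{1}}(n), \preccurlyeq')$ is isomorphic to the weak Bruhat order $(\mathfrak{S}(n), \preccurlyeq_{\mathfrak{S}})$ on permutations of size $n$.
   Context: $\mathbb{N} = \{0,1,2,\dots\}$ and $[n] = \{1,\dots,n\}$. A range map is a map $\delta : \mathbb{N}\setminus\{0\} \to \mathbb{N}$. It is rooted if $\delta(1) = 0$ and weakly increasing if $\delta(i) \leq \delta(i+1)$ for all $i\geq 1$. A $\delta$-cliff of size $n$ is a word $u = u_1\cdots u_n$ of nonnegative integers with $0 \leq u_i \leq \delta(i)$ for all $i \in [n]$; $\mathsf{Cl}_\delta(n)$ is the set of them. $\mathbf{1}$ denotes the range map $\mathbf{1}(i) = i-1$, which is rooted and weakly increasing. Trees. Let $\delta$ be rooted and weakly increasing, and $\Delta_\delta(i) := \delta(i+1)-\delta(i)$. A planar rooted tree $\mathrm{tree}_\delta(u)$ with internal nodes labeled bijectively by $1,\dots,n$ is attached to each $u \in \mathsf{Cl}_\delta(n)$ recursively: if $n=0$ it is the single leaf; otherwise write $u = u'a$ with $u' \in \mathsf{Cl}_\delta(n-1)$ and $a$ a letter, and $\mathrm{tree}_\delta(u)$ is obtained by grafting on the $(a+1)$-st leaf (leaves being numbered from left to right starting at $1$) of $\mathrm{tree}_\delta(u')$ an internal node labeled by $n$ having $\Delta_\delta(n)+1$ children, all of them leaves. (For $\delta=\mathbf{1}$ every internal node has exactly two children.) The order $\preccurlyeq'$. For $u,v\in \mathsf{Cl}_\delta(n)$, write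 $u \lessdot' v$ if there is an index $i\in[n]$ such that $v$ is obtained from $u$ by replacing $u_i$ by $u_i+1$, and all the children of the node labeled by $i$ in $\mathrm{tree}_\delta(u)$ are leaves, except possibly its first (leftmost) child. The relation $\preccurlyeq'$ is the reflexive and transitive closure of $\lessdot'$; it is an order relation. Weak Bruhat order. $\mathfrak{S}(n)$ is the set of permutations $\sigma = \sigma_1\cdots\sigma_n$ of $[n]$. A coinversion of $\sigma$ is a pair $(\sigma_j,\sigma_i)$ with $\sigma_j<\sigma_i$ and $i<j$. One has $\sigma \preccurlyeq_{\mathfrak{S}} \nu$ if the set of coinversions of $\sigma$ is contained in the set of coinversions of $\nu$. *)

(* Defs.v *)
From Stdlib Require Import Relation_Operators.
From mathcomp Require Import all_boot all_fingroup.

Set Implicit Arguments.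
Unset Strict Implicit.
Unset Printing Implicit Defensive.

(** Range maps are only ever evaluated at positive integers: the value at [0]
    is junk and plays no role. *)
Definition range_map := nat -> nat.

Definition rooted (delta : range_map) : Prop := delta 1 = 0.

Definition weakly_increasing (delta : range_map) : Prop :=
  forall i, 1 <= i -> delta i <= delta i.+1.

Definition one_map : range_map := fun i => i.-1.

Lemma one_map_rooted : rooted one_map.
Proof. by []. Qed.

Lemma one_map_weakly_increasing : weakly_increasing one_map.
Proof. by case. Qed.

(** Positions are counted from [0]: the letter [u_i] is [tnth u (i - 1)]. *)
Definition is_cliff (delta : range_map) n (u : n.-tuple nat) : bool :=
  [forall i : 'I_n, tnth u i <= delta i.+1].

Definition cliff (delta : range_map) (n : nat) : Type :=
  {u : n.-tuple nat | is_cliff delta u}.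

Definition cliff_word delta n (u : cliff delta n) : n.-tuple nat := val u.

(** [Node l cs] is an internal node labeled by [l] whose children are, from
    left to right, the trees in [cs]. *)
Inductive tree : Type :=
  | Leaf : tree
  | Node : nat -> seq tree -> tree.

Definition is_leaf (t : tree) : bool := if t is Leaf then true else false.

Fixpoint nleaves (t : tree) : nat :=
  match t with
  | Leaf => 1
  | Node _ cs => sumn (map nleaves cs)
  end.

(** [graft s k t] replaces by [s] the leaf of [t] having exactly [k] leaves to
    its left, that is, the [(k + 1)]-st leaf; it is [t] if there is no such
    leaf. *)
Fixpoint graft (s : tree) (k : nat) (t : tree) {struct t} : tree :=
  match t with
  | Leaf => if k == 0 then s else Leaf
  | Node l cs =>
      let fix graft_forest (k : nat) (cs : seq tree) {struct cs} : seq tree :=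
        match cs with
        | [::] => [::]
        | c :: cs' =>
            if k < nleaves c then graft s k c :: cs'
            else c :: graft_forest (k - nleaves c) cs'
        end
      in Node l (graft_forest k cs)
  end.

(** The subtraction is not truncated when [delta] is weakly increasing. *)
Definition Delta (delta : range_map) (i : nat) : nat := delta i.+1 - delta i.

Definition corolla (delta : range_map) (n : nat) : tree :=
  Node n (nseq (Delta delta n).+1 Leaf).

(** The word is read from its last letter: [w] is the reversal of [u]. *)
Fixpoint tree_of_rev (delta : range_map) (w : seq nat) : tree :=
  match w with
  | [::] => Leaf
  | a :: w' => graft (corolla delta (size w)) a (tree_of_rev delta w')
  end.

Definition tree_of (delta : range_map) (u : seq nat) : tree :=
  tree_of_rev delta (rev u).

Lemma tree_of_nil delta : tree_of delta [::] = Leaf.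
Proof. by []. Qed.

Lemma tree_of_rcons delta u a :
  tree_of delta (rcons u a) =
  graft (corolla delta (size u).+1) a (tree_of delta u).
Proof. by rewrite /tree_of rev_rcons /= size_rev. Qed.

(** The internal nodes of a tree, each given by its label and its children. *)
Fixpoint nodes (t : tree) : seq (nat * seq tree) :=
  match t with
  | Leaf => [::]
  | Node l cs => (l, cs) :: flatten (map nodes cs)
  end.

(** The labels of [tree_of delta u] are pairwise distinct, so that at most one
    node is concerned by the existential quantification [has]. *)
Definition node_free_after_first (i : nat) (t : tree) : bool :=
  has (fun p => (p.1 == i) && all is_leaf (behead p.2)) (nodes t).

Definition cliff_cover delta n (u v : cliff delta n) : Prop :=
  exists i : 'I_n,
    [/\ tnth (cliff_word v) i = (tnth (cliff_word u) i).+1,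
        forall j : 'I_n, j != i ->
          tnth (cliff_word v) j = tnth (cliff_word u) j
      & node_free_after_first i.+1 (tree_of delta (cliff_word u))].

Definition cliff_le delta n : cliff delta n -> cliff delta n -> Prop :=
  clos_refl_trans (cliff delta n) (@cliff_cover delta n).

(** Permutations act on [{0, ..., n - 1}] instead of [{1, ..., n}]: the letter
    [s_i] is [(s (i - 1)).+1]. *)
Definition coinversions n (s : 'S_n) : {set 'I_n * 'I_n} :=
  [set (s p.2, s p.1) | p : 'I_n * 'I_n & (p.1 < p.2) && (s p.2 < s p.1)].

Definition weak_le n (s t : 'S_n) : Prop := coinversions s \subset coinversions t.

Definition order_isomorphic (S T : Type)
    (leS : S -> S -> Prop) (leT : T -> T -> Prop) : Prop :=
  exists f : S -> T, bijective f /\ forall x y, leS x y <-> leT (f x) (f y).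

(* Main.v *)
Require Import Defs.
From Stdlib Require Import Relation_Operators.
From mathcomp Require Import all_boot all_fingroup.
From mathcomp Require Import zify.

Set Implicit Arguments.
Unset Strict Implicit.
Unset Printing Implicit Defensive.

(** The trees attached to these cliffs are binary increasing trees, and reading
    the labels of such a tree in infix order turns a cliff [u] into a word
    [word u] on [1, ..., n]: the leaves are the gaps before, between and after
    the letters, and grafting the node [n] inserts the letter [n] in the gap
    that has [u_n] letters on its left.  The letter [u_i]
    is recovered as the number of letters smaller than [i] on the left of [i],
    so [u] is a Lehmer code of [word u], and [word] is a bijection onto the
    rearrangements of [1, ..., n] ([code_word], [code_inj]).  Reversing the
    word gives a permutation [s] whose coinversions are the pairs [(j, i)],
    [j < i], in which [j] stands on the left of [i] in [word u].

    The covering relation becomes an adjacent transposition.  Because the tree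
    increases downwards, the right subtree of the node [i] is empty exactly
    when the letter after [i] in infix order is smaller than [i], or absent
    ([node_free_word]).  It cannot be absent when [u_i] may be increased.  If
    that letter is [j], exchanging the factor [i j] for [j i] increases [u_i]
    by one and changes no other letter of the code ([code_swap]).  So [u] is
    covered by [v] exactly when [word v] arises from [word u] by sorting one
    adjacent descent ([cliff_coverP]).

    It remains to see that inclusion of coinversions is the closure of these
    exchanges ([cliff_leP]).  An exchange only adds a coinversion.  Conversely,
    if the coinversions of [w] are among those of another word [w'], some two
    adjacent letters of [w] come in the other order in [w'], for otherwise [w]
    would be sorted according to the positions in [w'] and equal to it; by the
    inclusion they form a descent of [w] ([exists_swap]), exchanging them keeps
    the inclusion true, and the sum of the cliff increases by one, hence the
    process stops. *)

(** * Increasing binary trees *)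

Inductive bintree : Type :=
  | BLeaf : bintree
  | BNode : nat -> bintree -> bintree -> bintree.

Fixpoint to_tree (t : bintree) : tree :=
  match t with
  | BLeaf => Leaf
  | BNode l a b => Node l [:: to_tree a; to_tree b]
  end.

Fixpoint inorder (t : bintree) : seq nat :=
  match t with
  | BLeaf => [::]
  | BNode l a b => inorder a ++ l :: inorder b
  end.

(** Leaves correspond to the gaps between consecutive letters of the infix
    word, so the letters of the left subtree tell on which side the leaf
    number [k] is. *)
Fixpoint bgraft (n k : nat) (t : bintree) : bintree :=
  match t with
  | BLeaf => BNode n BLeaf BLeaf
  | BNode l a b =>
      if k <= size (inorder a) then BNode l (bgraft n k a) b
      else BNode l a (bgraft n (k - (size (inorder a)).+1) b)
  end.

Fixpoint increasing (t : bintree) : bool :=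
  match t with
  | BLeaf => true
  | BNode l a b =>
      [&& all (ltn l) (inorder a), all (ltn l) (inorder b),
          increasing a & increasing b]
  end.

Definition insert (x k : nat) (w : seq nat) : seq nat :=
  take k w ++ x :: drop k w.

Lemma all_insert p x k w : all p (insert x k w) = p x && all p w.
Proof.
by rewrite /insert all_cat /= -{3}(cat_take_drop k w) all_cat andbCA.
Qed.

Lemma perm_insert x k w : perm_eq (insert x k w) (x :: w).
Proof.
by rewrite /insert perm_catC /= perm_cons perm_catC cat_take_drop.
Qed.

Lemma nleaves_to_tree t : nleaves (to_tree t) = (size (inorder t)).+1.
Proof. by elim: t => //= l a -> b ->; rewrite size_cat /=; lia. Qed.

Lemma graft_to_tree n k t : k <= size (inorder t) ->
  graft (Node n [:: Leaf; Leaf]) k (to_tree t) = to_tree (bgraft n k t).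
Proof.
elim: t k => [|l a IHa b IHb] k /=; first by case: k.
rewrite size_cat /= !nleaves_to_tree ltnS => lek.
case: (leqP k (size (inorder a))) => [lea|lta] /=; first by rewrite IHa.
have -> : k - (size (inorder a)).+1 < (size (inorder b)).+1 by lia.
by rewrite IHb //; lia.
Qed.

Lemma inorder_bgraft n k t : k <= size (inorder t) ->
  inorder (bgraft n k t) = insert n k (inorder t).
Proof.
elim: t k => [|l a IHa b IHb] k /=; first by case: k.
rewrite size_cat /= => lek; rewrite /insert take_cat drop_cat.
case: (leqP k (size (inorder a))) => [lea|lta] /=.
  rewrite IHa // /insert; case: ltnP => [_|gea]; first by rewrite -catA.
  have -> : k = size (inorder a) by lia.
  by rewrite subnn take_size drop_size take0 drop0 cats0 -catA.
have -> : k < size (inorder a) = false by lia.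
rewrite IHb /insert; last by lia.
have -> : k - size (inorder a) = (k - (size (inorder a)).+1).+1 by lia.
by rewrite /= -catA.
Qed.

Lemma increasing_bgraft n k t : k <= size (inorder t) ->
  all (gtn n) (inorder t) -> increasing t -> increasing (bgraft n k t).
Proof.
elim: t k => [|l a IHa b IHb] k //=.
rewrite size_cat all_cat /= => lek /and3P[na nl nb] /and4P[la lb ia ib].
case: (leqP k (size (inorder a))) => [lea|lta] /=.
  by rewrite inorder_bgraft // all_insert /= nl la lb ib IHa.
rewrite inorder_bgraft ?all_insert /=; last by lia.
by rewrite nl la lb ia IHb //; lia.
Qed.

(** The default [0] of [head] acts as a final letter smaller than all labels,
    so that the last letter of a word also counts. *)
Fixpoint next_smaller (i : nat) (w : seq nat) : bool :=
  if w is x :: w' then (x == i) && (head 0 w' < i) || next_smaller i w'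
  else false.

(** The letter [l] is smaller than the last letter of [w], as is the sentinel
    that ends [w] alone. *)
Lemma next_smaller_cat i w l b : all (ltn l) w ->
  next_smaller i (w ++ l :: b) = next_smaller i w || next_smaller i (l :: b).
Proof.
elim: w => [//|x w IHw] /= /andP[lx lw]; rewrite IHw //= -orbA.
congr (_ || _); case: eqP => //= <-.
by case: w {IHw lw} => [|y w] //=; lia.
Qed.

Lemma next_smaller_swap p q i j : j < i -> next_smaller i (p ++ i :: j :: q).
Proof.
by move=> ltji; elim: p => [|x p IHp] /=; rewrite ?eqxx ?ltji ?IHp ?orbT.
Qed.

Lemma next_smallerP i w : next_smaller i w ->
  (exists p, w = rcons p i) \/
  exists p q j, j < i /\ w = p ++ i :: j :: q.
Proof.
elim: w => [//|x w IHw] /=.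
case/orP=> [/andP[/eqP->]|/IHw[[p ->]|[p [q [j [ltji ->]]]]]].
- case: w {IHw} => [|j q] /= lt; first by left; exists [::].
  by right; exists [::], q, j.
- by left; exists (x :: p).
- by right; exists (x :: p), q, j.
Qed.

(** The successor of a node in infix order is the first node of its right
    subtree, which has a larger label, or else an ancestor, which has a smaller
    one. *)
Lemma node_free_inorder i t : all (ltn 0) (inorder t) -> increasing t ->
  node_free_after_first i (to_tree t) = next_smaller i (inorder t).
Proof.
rewrite /node_free_after_first.
elim: t => [//|l a IHa b IHb] /=.
rewrite all_cat /= => /and3P[a0 l0 b0] /and4P[la lb ia ib].
rewrite cats0 has_cat IHa // IHb // next_smaller_cat //= orbCA.
congr (_ || (_ || _)); rewrite andbT; case: eqP => //= <-.
case: b lb {IHb b0 ib} => [|m c d] /=; first by rewrite l0.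
by case: (inorder c) => [|y s] /=; case/andP; lia.
Qed.

(** * Words and their codes *)

Fixpoint word_of_rev (u : seq nat) : seq nat :=
  if u is a :: u' then insert (size u) a (word_of_rev u') else [::].

Definition word (u : seq nat) : seq nat := word_of_rev (rev u).

Lemma word_rcons u a : word (rcons u a) = insert (size u).+1 a (word u).
Proof. by rewrite /word rev_rcons /= size_rev. Qed.

Lemma perm_word u : perm_eq (word u) (iota 1 (size u)).
Proof.
elim/last_ind: u => [//|u a IHu]; rewrite word_rcons size_rcons.
rewrite (permPl (perm_insert _ _ _)) -{2}addn1 iotaD cats1 add1n.
by rewrite perm_sym perm_rcons perm_cons perm_sym.
Qed.

Definition bounded (u : seq nat) : Prop :=
  forall i, i < size u -> nth 0 u i <= i.

Lemma bounded_rcons u a : bounded (rcons u a) -> bounded u /\ a <= size u.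
Proof.
move=> ua; split=> [i iu|].
  by have := ua i; rewrite size_rcons nth_rcons iu; apply; lia.
by have := ua (size u); rewrite size_rcons nth_rcons ltnn eqxx; apply.
Qed.

(** A tree with [n - 1] nodes has [n] leaves, so the bound on the letter [u_n]
    says that the leaf to be grafted on exists. *)
Lemma tree_of_bounded u : bounded u ->
  exists t, [/\ tree_of one_map u = to_tree t, inorder t = word u
              & increasing t].
Proof.
elim/last_ind: u => [|u a IHu]; first by exists BLeaf.
move=> /bounded_rcons[/IHu[t [ut tw it]] au].
have at_ : a <= size (inorder t).
  by rewrite tw (perm_size (perm_word u)) size_iota.
exists (bgraft (size u).+1 a t); split.
- rewrite tree_of_rcons ut /corolla.
  have -> : Delta one_map (size u).+1 = 1 by rewrite /Delta /one_map /=; lia.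
  exact: graft_to_tree.
- by rewrite inorder_bgraft // word_rcons tw.
- apply: increasing_bgraft => //; apply/allP => x.
  by rewrite tw (perm_mem (perm_word u)) mem_iota /=; lia.
Qed.

Lemma node_free_word u i : bounded u ->
  node_free_after_first i (tree_of one_map u) = next_smaller i (word u).
Proof.
move=> /tree_of_bounded[t [-> tw it]]; rewrite -tw node_free_inorder // tw.
by apply/allP => x; rewrite (perm_mem (perm_word u)) mem_iota => /andP[].
Qed.

(** The number of letters smaller than [i] on the left of [i]: after deleting
    the letters larger than [i], all that precedes [i] is smaller.  In this
    form the code visibly ignores the insertion of larger letters. *)
Definition code (w : seq nat) (i : nat) : nat := index i [seq x <- w | x <= i].

Lemma code_insert x k w i : i < x -> code (insert x k w) i = code w i.
Proof.
move=> ix; rewrite /code /insert filter_cat /= [x <= i]leqNgt ix /=.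
by rewrite -filter_cat cat_take_drop.
Qed.

Lemma code_max w i : all (geq i) w -> code w i = index i w.
Proof. by move=> wi; rewrite /code (all_filterP _). Qed.

Lemma code_word u i : bounded u -> i < size u ->
  code (word u) i.+1 = nth 0 u i.
Proof.
elim/last_ind: u => [//|u a IHu] /bounded_rcons[bu au].
rewrite size_rcons word_rcons nth_rcons => iu.
have wu x : (x \in word u) = (0 < x <= size u).
  by rewrite (perm_mem (perm_word u)) mem_iota; lia.
case: ltnP => [lt|ge]; first by rewrite code_insert // IHu.
have {iu ge}-> : i = size u by lia.
rewrite eqxx code_max; last first.
  by rewrite all_insert /= leqnn; apply/allP => x; rewrite wu /=; lia.
have nw : (size u).+1 \notin take a (word u).
  by apply/negP => /mem_take; rewrite wu; lia.
rewrite /insert index_cat (negPf nw) /= eqxx addn0 size_takel //.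
by rewrite (perm_size (perm_word u)) size_iota.
Qed.

Lemma perm_filter_leq n w i : perm_eq w (iota 1 n) -> i <= n ->
  perm_eq [seq x <- w | x <= i] (iota 1 i).
Proof.
move=> pw lein; apply: uniq_perm; rewrite ?filter_uniq ?iota_uniq //.
  by rewrite (perm_uniq pw) iota_uniq.
by move=> x; rewrite mem_filter (perm_mem pw) !mem_iota; lia.
Qed.

Lemma word_split n w : perm_eq w (iota 1 n.+1) ->
  w = insert n.+1 (code w n.+1) [seq x <- w | x <= n] /\
  perm_eq [seq x <- w | x <= n] (iota 1 n).
Proof.
move=> pw.
have wE x : (x \in w) = (0 < x <= n.+1).
  by rewrite (perm_mem pw) mem_iota; lia.
have uw : uniq w by rewrite (perm_uniq pw) iota_uniq.
split; last by apply: perm_filter_leq pw _.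
rewrite code_max; last by apply/allP => x; rewrite wE /=; lia.
have nw : n.+1 \in w by rewrite wE; lia.
case/splitPr: nw uw wE => p q; rewrite cat_uniq /= negb_or.
case/and4P=> _ /andP[np _] nq _ wE.
have small s : {subset s <= p ++ n.+1 :: q} -> n.+1 \notin s ->
    [seq x <- s | x <= n] = s.
  move=> sw ns; apply/all_filterP/allP => x xs.
  have := sw x xs; rewrite wE.
  have : x != n.+1 by apply: contraNneq ns => <-.
  by lia.
rewrite index_cat (negPf np) /= eqxx addn0 filter_cat /= ltnn.
rewrite !small // => [|x|x]; rewrite ?mem_cat ?inE => *; last first.
- exact/orP/or_introl.
- by apply/orP; right; apply/orP; right.
by rewrite /insert take_size_cat // drop_size_cat.
Qed.

(** A word is determined by the position of its largest letter and by the word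
    obtained when this letter is deleted, which has the same code. *)
Lemma code_inj n w w' : perm_eq w (iota 1 n) -> perm_eq w' (iota 1 n) ->
  (forall i, i < n -> code w i.+1 = code w' i.+1) -> w = w'.
Proof.
elim: n w w' => [|n IHn] w w' pw pw' eqc.
  by move/perm_nilP: pw => ->; move/perm_nilP: pw' => ->.
have [ew pf] := word_split pw; have [ew' pf'] := word_split pw'.
rewrite ew ew' eqc //; congr insert; apply: IHn => // i ltin.
have cf v : code [seq x <- v | x <= n] i.+1 = code v i.+1.
  rewrite /code -filter_predI; congr (index _ _).
  by apply: eq_filter => x /=; lia.
by rewrite !cf eqc // ltnS ltnW.
Qed.

Lemma code_bound n w i : perm_eq w (iota 1 n) -> i < n -> code w i.+1 <= i.
Proof.
move=> pw ltin.
have uf := perm_filter_leq pw ltin.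
rewrite -ltnS -[X in _ < X](size_iota 1) -(perm_size uf) index_mem.
by rewrite (perm_mem uf) mem_iota; lia.
Qed.

Lemma word_code n w u : perm_eq w (iota 1 n) -> size u = n ->
  (forall i, i < n -> nth 0 u i = code w i.+1) -> word u = w.
Proof.
move=> pw su cu; apply: (@code_inj n) => // [|i ltin].
  by rewrite -su perm_word.
rewrite code_word ?su ?cu // => k; rewrite su => ltkn.
by rewrite cu // (code_bound pw).
Qed.

(** The last letter has all the smaller ones on its left: its code cannot be
    increased. *)
Lemma code_last n p i : perm_eq (rcons p i) (iota 1 n) ->
  code (rcons p i) i = i.-1.
Proof.
move=> pw.
have lein : i <= n.
  have : i \in rcons p i by rewrite mem_rcons inE eqxx.
  by rewrite (perm_mem pw) mem_iota; lia.
have := perm_size (perm_filter_leq pw lein).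
have : uniq (rcons p i) by rewrite (perm_uniq pw) iota_uniq.
rewrite rcons_uniq => /andP[ip _].
rewrite /code filter_rcons leqnn size_rcons size_iota => sz.
rewrite -cats1 index_cat mem_filter (negPf ip) andbF /= eqxx addn0.
by rewrite -(congr1 predn sz).
Qed.

(** For [k < i] the letter [i] is not seen by the code, and for [k > i] the
    exchange takes place on one side of [k]. *)
Lemma code_swap p q i j k : uniq (p ++ i :: j :: q) -> j < i ->
  code (p ++ j :: i :: q) k = (k == i) + code (p ++ i :: j :: q) k.
Proof.
rewrite /code !filter_cat !index_cat /= => + ltji.
rewrite cat_uniq /= !inE !negb_or.
case/and5P=> _ /and3P[ip jp _] /andP[nij iq] jq _.
rewrite !mem_filter.
case: (ltngtP k i) => [lt|gt|->].
- by rewrite add0n.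
- have -> : j <= k by lia.
  rewrite add0n /=.
  have -> : i == k = false by lia.
  by have -> : j == k = false by lia.
rewrite (ltnW ltji) (negPf ip) /= andbF !eqxx.
have -> : j == i = false by lia.
by rewrite addn0 addnC.
Qed.

(** * Inclusion of noninversions *)

(** Noninversions of a word are the coinversions of the reversed word, so this
    is the weak order read on reversed words. *)
Definition noninv_sub (w w' : seq nat) : Prop :=
  forall j i, j < i -> i \in w -> j \in w ->
    index j w < index i w -> index j w' < index i w'.

Lemma index_swap (p q : seq nat) i j x y : (x, y) != (j, i) ->
  index x (p ++ j :: i :: q) < index y (p ++ j :: i :: q) ->
  index x (p ++ i :: j :: q) < index y (p ++ i :: j :: q).
Proof.
rewrite !xpair_eqE !index_cat /=.
have := index_mem x p; have := index_mem y p.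
case: (x \in p); case: (y \in p) => //= hy hx; rewrite ?hx ?hy; try lia.
by rewrite ![_ == x]eq_sym ![_ == y]eq_sym; do !case: eqP => //=; lia.
Qed.

Lemma perm_swap (p q : seq nat) i j :
  perm_eq (p ++ i :: j :: q) (p ++ j :: i :: q).
Proof. by rewrite perm_cat2l (perm_catCA [:: i] [:: j] q). Qed.

Lemma unsorted_split (T : Type) (r : rel T) w : ~~ sorted r w ->
  exists p q x y, w = p ++ x :: y :: q /\ ~~ r x y.
Proof.
case: w => [//|x w]; elim: w x => [//|y w IHw] x /=.
rewrite negb_and => /orP[nrxy|/IHw[p [q [a [b [-> nrab]]]]]].
  by exists [::], w, x, y.
by exists (x :: p), q, a, b.
Qed.

(** If no two adjacent letters of [w] came in the other order in [w'], then [w]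
    would be sorted by position in [w'], as [w'] is. *)
Lemma exists_swap w w' : uniq w -> perm_eq w w' -> noninv_sub w w' -> w <> w' ->
  exists p q i j, [/\ j < i, w = p ++ i :: j :: q & index j w' < index i w'].
Proof.
move=> uw pw sub neq.
pose r := [rel x y | index x w' < index y w'].
have [sw|] := boolP (sorted r w).
  case: neq; apply: (@irr_sorted_eq _ r) => //.
  - by move=> y x z /=; apply: ltn_trans.
  - by move=> x /=; apply: ltnn.
  - apply/(sortedP 0) => k lt /=.
    by rewrite !index_uniq -?(perm_uniq pw) // ltnW.
  - exact: perm_mem.
case/unsorted_split=> p [q [x [y [ew]]]] /=; rewrite -leqNgt => leyx.
have xw : x \in w by rewrite ew mem_cat !inE eqxx orbT.
have yw : y \in w by rewrite ew mem_cat !inE eqxx !orbT.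
have nxy : x != y.
  by apply: contraTneq uw => exy; rewrite ew cat_uniq exy /= inE eqxx !andbF.
have ltyx : index y w' < index x w'.
  rewrite ltn_neqAle leyx andbT; apply: contraNneq nxy => eyx.
  by rewrite -(nth_index 0 (_ : x \in w')) -?eyx ?nth_index // -(perm_mem pw).
exists p, q, x, y; split=> //; case: (ltngtP y x) => // [ltxy|exy]; last first.
  by rewrite exy eqxx in nxy.
suff lt : index x w < index y w by have := sub x y ltxy yw xw lt; lia.
rewrite ew.
have xp : x \notin p.
  by apply: contraTN uw => xp; rewrite ew cat_uniq /= xp /= !andbF.
have yp : y \notin p.
  by apply: contraTN uw => yp; rewrite ew cat_uniq /= yp orbT !andbF.
by rewrite !index_cat (negPf xp) (negPf yp) /= eqxx (negPf nxy) ltn_add2l.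
Qed.

(** * Permutations *)

(** The reversal accounts for the tree order and the weak order going in
    opposite directions: increasing a letter of a cliff sorts a descent of
    its infix word, which removes a coinversion there and adds one to the
    reversed word. *)
Definition one_line_rev n (s : 'S_n) : seq nat :=
  rev [seq (s i).+1 | i <- enum 'I_n].

Lemma one_line_revE n (s : 'S_n) :
  one_line_rev s = rev [tuple tnth (iota_tuple n 1) (s i) | i < n].
Proof.
congr rev; apply: eq_map => i /=.
by rewrite (tnth_nth 0) nth_iota.
Qed.

Lemma perm_one_line_rev n (s : 'S_n) : perm_eq (one_line_rev s) (iota 1 n).
Proof.
rewrite one_line_revE perm_rev.
by apply/(@tuple_permP _ _ _ (iota_tuple n 1)); exists s.
Qed.

Lemma one_line_rev_surj n w : perm_eq w (iota 1 n) ->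
  exists s : 'S_n, one_line_rev s == w.
Proof.
rewrite -perm_rev => /(@tuple_permP _ _ _ (iota_tuple n 1))[s ws].
by exists s; rewrite one_line_revE -ws revK.
Qed.

Lemma one_line_rev_inj n : injective (@one_line_rev n).
Proof.
move=> s t /(can_inj revK) est; apply/permP => i; apply/val_inj.
have /eq_in_map/(_ i) := est.
by rewrite mem_enum => /(_ isT)[].
Qed.

Lemma index_one_line_rev n (s : 'S_n) i :
  index (s i).+1 (one_line_rev s) = n - i.+1.
Proof.
have sz : size (one_line_rev s) = n.
  by rewrite (perm_size (perm_one_line_rev s)) size_iota.
have ltin := ltn_ord i.
have <- : nth 0 (one_line_rev s) (n - i.+1) = (s i).+1.
  rewrite nth_rev size_map size_enum_ord; last by lia.
  have -> : n - (n - i.+1).+1 = i by lia.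
  by rewrite (nth_map i) ?size_enum_ord // nth_ord_enum.
rewrite index_uniq ?sz //; first by lia.
by rewrite (perm_uniq (perm_one_line_rev s)) iota_uniq.
Qed.

Lemma mem_coinversions n (s : 'S_n) (x y : 'I_n) :
  ((x, y) \in coinversions s) =
  (x < y) && (index x.+1 (one_line_rev s) < index y.+1 (one_line_rev s)).
Proof.
apply/imsetP/idP => [[[i j]]|/andP[ltxy]].
  rewrite inE /= => /andP[ltij ltji] [-> ->].
  rewrite ltji !index_one_line_rev.
  by have := ltn_ord j; lia.
rewrite -[x](permKV s) -[y](permKV s) !index_one_line_rev => lt.
exists (s^-1 y, s^-1 x)%g => //=.
by rewrite inE /= !permKV ltxy; lia.
Qed.

Lemma weak_leP n (s t : 'S_n) :
  weak_le s t <-> noninv_sub (one_line_rev s) (one_line_rev t).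
Proof.
split=> [/subsetP sub j i ltji|sub].
  rewrite !(perm_mem (perm_one_line_rev s)) !mem_iota add1n !ltnS.
  case: i j ltji => [|i] [|j] //= ltji ltin ltjn lt.
  have := sub (Ordinal ltjn, Ordinal ltin); rewrite !mem_coinversions /=.
  by rewrite -ltnS ltji lt => /(_ isT).
apply/subsetP => [[x y]]; rewrite !mem_coinversions => /andP[ltxy lt].
rewrite ltxy sub // (perm_mem (perm_one_line_rev s)) mem_iota /=.
  by rewrite add1n ltnS.
by rewrite add1n ltnS.
Qed.

(** * The order on cliffs *)

Lemma cliff_bounded n (u : cliff one_map n) : bounded (cliff_word u).
Proof.
move=> i; rewrite size_tuple => ltin.
by have /forallP/(_ (Ordinal ltin)) := valP u; rewrite (tnth_nth 0).
Qed.

Lemma perm_cliff n (u : cliff one_map n) :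
  perm_eq (word (cliff_word u)) (iota 1 n).
Proof. by rewrite -[X in iota 1 X](size_tuple (cliff_word u)) perm_word. Qed.

Lemma code_cliff n (u : cliff one_map n) (i : 'I_n) :
  code (word (cliff_word u)) i.+1 = tnth (cliff_word u) i.
Proof.
by rewrite (tnth_nth 0) code_word ?size_tuple //; apply: cliff_bounded.
Qed.

Lemma word_cliff_inj n (u v : cliff one_map n) :
  word (cliff_word u) = word (cliff_word v) -> u = v.
Proof.
move=> euv; apply/val_inj/eq_from_tnth => i.
by rewrite -!code_cliff euv.
Qed.

Lemma is_cliff_code n w : perm_eq w (iota 1 n) ->
  is_cliff one_map [tuple code w i.+1 | i < n].
Proof.
by move=> pw; apply/forallP => i; rewrite tnth_mktuple (code_bound pw).
Qed.

Definition cliff_of_word n w (pw : perm_eq w (iota 1 n)) : cliff one_map n :=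
  exist (fun u : n.-tuple nat => is_cliff one_map u) _ (is_cliff_code pw).

Lemma word_cliff_of_word n w (pw : perm_eq w (iota 1 n)) :
  word (cliff_word (cliff_of_word pw)) = w.
Proof.
apply: word_code (pw) _ _ => [|i ltin]; first exact: size_tuple.
by rewrite -(tnth_nth 0 _ (Ordinal ltin)) tnth_mktuple.
Qed.

(** In one direction, a node that is free after its first child is followed by
    a smaller letter, since its code can still be increased; in the other, the
    exchanged factor gives both the free node and the new code. *)
Lemma cliff_coverP n (u v : cliff one_map n) : cliff_cover u v <->
  exists p q i j, [/\ j < i, word (cliff_word u) = p ++ i :: j :: q
                    & word (cliff_word v) = p ++ j :: i :: q].
Proof.
have pu := perm_cliff u; have pv := perm_cliff v.
have uu : uniq (word (cliff_word u)) by rewrite (perm_uniq pu) iota_uniq.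
split=> [[i [vi vj]]|[p [q [i [j [ltji eu ev]]]]]].
  rewrite node_free_word; last exact: cliff_bounded.
  case/next_smallerP=> [[p eu]|[p [q [j [ltji eu]]]]].
    have := code_bound pv (ltn_ord i); rewrite code_cliff vi -code_cliff eu.
    by rewrite (@code_last n) -?eu //= ltnn.
  exists p, q, i.+1, j; split=> //.
  apply: (@code_inj n) => // [|k ltkn].
    by rewrite -(permPl (perm_swap _ _ _ _)) -eu.
  rewrite code_swap -?eu // -[k]/(val (Ordinal ltkn)) !code_cliff.
  have [->|nki] := eqVneq (Ordinal ltkn) i; first by rewrite eqxx vi.
  by rewrite vj // eqSS val_eqE (negPf nki).
have : i \in word (cliff_word u) by rewrite eu mem_cat inE eqxx orbT.
rewrite (perm_mem pu) mem_iota add1n ltnS.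
case: i ltji eu ev => // i ltji eu ev ltin; exists (Ordinal ltin).
have cv k : code (word (cliff_word v)) k =
    (k == i.+1) + code (word (cliff_word u)) k.
  by rewrite ev eu; apply: code_swap; rewrite -?eu.
split=> [|k nki|].
- by rewrite -!code_cliff cv eqxx.
- by rewrite -!code_cliff cv eqSS -[i]/(val (Ordinal ltin)) val_eqE (negPf nki).
- rewrite node_free_word; last exact: cliff_bounded.
  by rewrite eu next_smaller_swap.
Qed.

Lemma cliff_cover_noninv_sub n (u v : cliff one_map n) :
  cliff_cover u v -> noninv_sub (word (cliff_word u)) (word (cliff_word v)).
Proof.
case/cliff_coverP=> p [q [i [j [ltji -> ->]]]] y x ltyx _ _.
by apply: index_swap; apply: contraTneq ltyx => -[-> ->]; rewrite -leqNgt ltnW.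
Qed.

Lemma sum_cliff n (u : cliff one_map n) :
  \sum_(i < n) tnth (cliff_word u) i <= n * n.
Proof.
rewrite -[X in _ <= X * _]card_ord -sum_nat_const; apply: leq_sum => i _.
have := cliff_bounded (u := u) (i := i); rewrite size_tuple (tnth_nth 0).
by move=> /(_ (ltn_ord i)) /leq_trans; apply; apply: ltnW.
Qed.

Lemma sum_cliff_cover n (u v : cliff one_map n) : cliff_cover u v ->
  \sum_(i < n) tnth (cliff_word u) i < \sum_(i < n) tnth (cliff_word v) i.
Proof.
case=> i [vi vj _]; rewrite (bigD1 i) //= [in X in _ < X](bigD1 i) //= vi ltnS.
by rewrite leq_add2l leq_sum // => j nji; rewrite vj.
Qed.

(** Starting from [u], repeatedly exchange an adjacent descent of its word whose
    letters come in the other order in the word of [v].  The sum of the letters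
    of the cliff, bounded by [n * n], increases at each cover and measures the
    progress. *)
Lemma cliff_leP n (u v : cliff one_map n) :
  cliff_le u v <-> noninv_sub (word (cliff_word u)) (word (cliff_word v)).
Proof.
split=> [|sub].
  elim=> {u v} [u v|u|u v w _ uv _ vw]; [exact: cliff_cover_noninv_sub|by []|].
  move=> j i ltji iu ju lt; apply: vw (uv _ _ ltji iu ju lt) => //.
    by rewrite (perm_mem (perm_cliff v)) -(perm_mem (perm_cliff u)).
  by rewrite (perm_mem (perm_cliff v)) -(perm_mem (perm_cliff u)).
have [m] := ubnP (n * n - \sum_(i < n) tnth (cliff_word u) i).
elim: m u sub => [//|m IHm] u sub; rewrite ltnS => leum.
have [/word_cliff_inj->|/eqP neq] :=
  eqVneq (word (cliff_word u)) (word (cliff_word v)); first exact: rt_refl.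
have pu := perm_cliff u.
have uu : uniq (word (cliff_word u)) by rewrite (perm_uniq pu) iota_uniq.
have puv : perm_eq (word (cliff_word u)) (word (cliff_word v)).
  by rewrite (permPl pu) perm_sym perm_cliff.
have [p [q [i [j [ltji eu ltv]]]]] := exists_swap uu puv sub neq.
have pw : perm_eq (p ++ j :: i :: q) (iota 1 n).
  by rewrite -(permPl (perm_swap _ _ _ _)) -eu.
pose u' := cliff_of_word pw.
have cu : cliff_cover u u'.
  by apply/cliff_coverP; exists p, q, i, j; rewrite word_cliff_of_word.
apply: rt_trans (rt_step _ _ _ _ cu) (IHm u' _ _); last first.
  by have := sum_cliff_cover cu; have := sum_cliff u'; lia.
move=> y x ltyx; rewrite word_cliff_of_word => xu yu ltw.
(* The only noninversion created by the exchange is [(j, i)], and it is one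
   of [word v] by the choice of the exchanged letters. *)
have [[-> ->] //|nyx] := eqVneq (y, x) (j, i).
have memw z : z \in p ++ j :: i :: q -> z \in word (cliff_word u).
  by rewrite (perm_mem pw) (perm_mem pu).
apply: sub ltyx _ _ _; [exact: memw|exact: memw|rewrite eu].
exact: index_swap ltw.
Qed.

Theorem proposition1p2p1 (n : nat) :
  order_isomorphic (@cliff_le one_map n) (@weak_le n).
Proof.
pose f (u : cliff one_map n) : 'S_n :=
  xchoose (one_line_rev_surj (perm_cliff u)).
have fE u : one_line_rev (f u) = word (cliff_word u).
  exact/eqP/(xchooseP (one_line_rev_surj (perm_cliff u))).
exists f; split; last first.
  by move=> u v; rewrite cliff_leP weak_leP !fE.
exists (fun s => cliff_of_word (perm_one_line_rev s)) => [u|s].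
  by apply: word_cliff_inj; rewrite word_cliff_of_word fE.
by apply: one_line_rev_inj; rewrite fE word_cliff_of_word.
Qed.
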